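(* Let $D\subset\mathbb{R}^d$ be a compact set of positive Lebesgue measure, let $\xi\in\mathbb{R}^d$ be a unit vector, and let $n,m\ge 1$ be integers. Then $$C(\mathcal{P}_n,D)\ge c\left(\int_0^{n^{-2}}A_{D,\xi}(t)\,dt+n^{-2m}\int_{n^{-2}}^\infty A_{D,\xi}(t)\,t^{-m}\,dt\right)^{-1},$$ where $c=c_{m,D}>0$ depends only on $m$ and $D$ (in fact, only on $m$ and the diameter of $D$), and does not depend on $n$. In particular, if $A_{D,\xi}(t)\le Mt^\lambda$ for some $M>0$, $\lambda<m-1$ and all $t>0$, then $$C(\mathcal{P}_n,D)\ge c\,n^{2(1+\lambda)},$$ where $c>0$ does not depend on $n$ and may, in addition, depend on $M$ and $\lambda$.
   Context: $\mathcal{P}_n=\mathcal{P}_{n,d}$ is the space of real algebraic polynomials in $d$ variables of total degree $\le n$. For a compact set $D\subset\mathbb{R}^d$ of positive Lebesgue measure and $x\in\mathbb{R}^d$, $C(\mathcal{P}_n,D,x)=\sum_{k=1}^N\phi_k(x)^2$, where $\{\phi_k\}_{k=1}^N$ is any basis of $\mathcal{P}_n$ that is orthonormal in $L_2(D)$ with respect to Lebesgue measure (the value does not depend on the choice of the orthonormal basis); $C(\mathcal{P}_n,D)=\sup_{x\in D}C(\mathcal{P}_n,D,x)$. For a unit vector $\xi$ and a non-empty compact set $D$, the parallel section function is $A_{D,\xi}(t)=\mathrm{Vol}_{d-1}(D\cap\{x\in\mathbb{R}^d:x\cdot\xi=t+h\})$, where $h=\min_{x\in D}x\cdot\xi$ and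 $\mathrm{Vol}_{d-1}$ is the $(d-1)$-dimensional Lebesgue measure (on the hyperplane). *)

(* Defs.v *)
From HB Require Import structures.
From mathcomp Require Import all_boot all_order all_algebra.
From mathcomp Require Import all_classical all_reals all_analysis.
From mathcomp Require mpoly.
Import (canonicals, coercions) mpoly.

Set Implicit Arguments.
Unset Strict Implicit.
Unset Printing Implicit Defensive.
Import Order.TTheory GRing.Theory Num.Theory.
Import numFieldNormedType.Exports.
Local Open Scope classical_set_scope.
Local Open Scope ring_scope.

(* The product sigma-algebra on row vectors, as the library does for tuples;
   for [T] the reals it is the Borel sigma-algebra of R^n. *)
Definition measure_rV_display : measure_display -> measure_display.
Proof. exact. Qed.

Section measurable_rV.
Context {d} {T : measurableType d}.
Variable n : nat.

Let coors : 'I_n -> 'rV[T]_n -> T := fun i x => x ord0 i.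

Let rV_set0 : g_sigma_preimage coors set0.
Proof. exact: sigma_algebra0. Qed.

Let rV_setC A : g_sigma_preimage coors A -> g_sigma_preimage coors (~` A).
Proof. exact: sigma_algebraC. Qed.

Let rV_bigcup (F : _^nat) : (forall i, g_sigma_preimage coors (F i)) ->
  g_sigma_preimage coors (\bigcup_i (F i)).
Proof. exact: sigma_algebra_bigcup. Qed.

HB.instance Definition _ := @isMeasurable.Build (measure_rV_display d)
  'rV[T]_n (g_sigma_preimage coors) rV_set0 rV_setC rV_bigcup.

Lemma measurable_coord_rV (i : 'I_n) :
  measurable_fun [set: 'rV[T]_n] (fun x : 'rV[T]_n => x ord0 i).
Proof.
move=> _ Y mY; rewrite setTI; apply: sub_sigma_algebra => /=.
rewrite -bigcup_seq/=; exists i => /=; first by rewrite mem_index_enum.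
by exists Y => //; rewrite setTI.
Qed.

Lemma measurable_fun_rVP d1 (T1 : measurableType d1) (f : T1 -> 'rV[T]_n) :
  (forall i, measurable_fun [set: T1] (fun x => f x ord0 i)) ->
  measurable_fun [set: T1] f.
Proof.
move=> mf; have H : g_sigma_preimage (fun i => coors i \o f) `<=` measurable.
  apply: smallest_sub; first exact: sigma_algebra_measurable.
  move=> A; rewrite -bigcup_seq => -[i _ [B mB <-]].
  exact: mf.
by move: H; rewrite g_sigma_preimage_comp => H _ A mA; apply: H; exists A.
Qed.

End measurable_rV.

Section lebesgue_measure_rV.
Context {R : realType}.

Definition cons_rV n (p : measurableTypeR R * 'rV[R]_n) : 'rV[R]_n.+1 :=
  row_mx (const_mx p.1 : 'rV_1) p.2.

Lemma measurable_cons_rV n : measurable_fun setT (@cons_rV n).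
Proof.
apply: measurable_fun_rVP => i; rewrite /cons_rV.
under eq_fun do rewrite mxE.
case: (@fintype.split 1 n i) => j.
  by under eq_fun do rewrite mxE; exact: measurable_fst.
exact: (measurableT_comp (measurable_coord_rV j) measurable_snd).
Qed.

Definition uncons_rV n (x : 'rV[R]_n.+1) : measurableTypeR R * 'rV[R]_n :=
  (x ord0 ord0, rsubmx (x : 'rV_(1 + n))).

Lemma cons_rVK n (p : measurableTypeR R * 'rV[R]_n) : uncons_rV (cons_rV p) = p.
Proof.
case: p => a y; rewrite /uncons_rV /cons_rV row_mxKr; congr pair.
by rewrite mxE; case: (@fintype.splitP 1 n ord0) => // j _; rewrite mxE.
Qed.

Lemma measurable_uncons_rV n : measurable_fun setT (@uncons_rV n).
Proof.
apply/measurable_fun_pair => /=; first exact: measurable_coord_rV.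
apply: measurable_fun_rVP => i; under eq_fun do rewrite mxE.
exact: measurable_coord_rV.
Qed.

Section lebesgue_cons.
Context {n : nat} (mu : {sigma_finite_measure set 'rV[R]_n -> \bar R}).

Definition lebesgue_cons : set 'rV[R]_n.+1 -> \bar R :=
  pushforward (lebesgue_measure \x mu)%E (@cons_rV n).

Let measurable_preimage_cons A : measurable A -> measurable (@cons_rV n @^-1` A).
Proof. by move=> mA; rewrite -[X in measurable X]setTI; exact: measurable_cons_rV. Qed.

Let lebesgue_cons0 : lebesgue_cons set0 = 0%E.
Proof. by rewrite /lebesgue_cons /pushforward preimage_set0 measure0. Qed.

Let lebesgue_cons_ge0 A : (0 <= lebesgue_cons A)%E.
Proof. by rewrite /lebesgue_cons /pushforward; exact: measure_ge0. Qed.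

Let lebesgue_cons_sigma_additive : semi_sigma_additive lebesgue_cons.
Proof.
move=> F mF tF mUF; rewrite /lebesgue_cons /pushforward preimage_bigcup.
apply: measure_semi_sigma_additive.
- by move=> k; exact: measurable_preimage_cons.
- apply/trivIsetP => i j _ _ ij; rewrite -preimage_setI.
  by move/trivIsetP : tF => /(_ _ _ Logic.I Logic.I ij) ->; rewrite preimage_set0.
- by rewrite -preimage_bigcup; exact: measurable_preimage_cons.
Qed.

HB.instance Definition _ := isMeasure.Build _ _ _ lebesgue_cons
  lebesgue_cons0 lebesgue_cons_ge0 lebesgue_cons_sigma_additive.

Let lebesgue_cons_sigma_finite : sigma_finite setT lebesgue_cons.
Proof.
have /sigma_finiteP[F [TF ndF Foo]] := sigma_finiteT (@lebesgue_measure R).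
have /sigma_finiteP[G [TG ndG Goo]] := sigma_finiteT mu.
exists (fun k => @uncons_rV n @^-1` (F k `*` G k)).
  rewrite -preimage_bigcup -[LHS](preimage_setT (@uncons_rV n)); congr preimage.
  rewrite -setXTT TF TG predeqE => -[x y]; split.
    move=> [/= [k _ Fkx] [l _ Gly]]; exists (maxn k l) => //; split.
    - by move: x Fkx; exact/subsetPset/ndF/leq_maxl.
    - by move: y Gly; exact/subsetPset/ndG/leq_maxr.
  by move=> [k _ []/= ? ?]; split; exists k.
move=> k; have [mF Fy] := Foo k; have [mG Gy] := Goo k; split.
  rewrite -[X in measurable X]setTI.
  by apply: measurable_uncons_rV => //; exact: measurableX.
rewrite /lebesgue_cons /pushforward -comp_preimage.
rewrite (_ : _ \o _ = id); last by apply/funext => p /=; rewrite cons_rVK.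
by rewrite product_measure1E// lte_mul_pinfty// ge0_fin_numE.
Qed.

HB.instance Definition _ :=
  Measure_isSigmaFinite.Build _ _ _ lebesgue_cons lebesgue_cons_sigma_finite.

End lebesgue_cons.

Fixpoint lebesgue_rV n : {sigma_finite_measure set 'rV[R]_n -> \bar R} :=
  match n with
  | 0 => \d_(0 : 'rV[R]_0)
  | n.+1 => lebesgue_cons (lebesgue_rV n)
  end.

End lebesgue_measure_rV.

Section polynomials.
Context {R : realType} {d : nat}.
Implicit Types (D : set 'rV[R]_d) (x y : 'rV[R]_d).

Definition dotr x y : R := (x *m y^T) ord0 ord0.

(* The library norm on row vectors is the sup norm. *)
Definition enorm x : R := Num.sqrt (dotr x x).

Definition diameter D : R := sup [set enorm (p.1 - p.2) | p in D `*` D].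

Definition peval (p : mpoly.mpoly d R) x : R := mpoly.meval (x ord0) p.

(* [mpoly.msize p] is one more than the total degree of [p], and 0 for [p = 0]. *)
Definition polys (n : nat) : set (mpoly.mpoly d R) :=
  [set p | (mpoly.msize p <= n.+1)%N].

(* Linear independence of [phi] is a consequence of orthonormality. *)
Definition orthonormal_basis D (n N : nat) (phi : 'I_N -> mpoly.mpoly d R) :=
  polys n = range (fun a : 'I_N -> R => \sum_k a k *: phi k) /\
  forall j k, (\int[lebesgue_rV d]_(x in D) (peval (phi j) x * peval (phi k) x)%:E
               = ((j == k)%:R : R)%:E)%E.

(* C(P_n, D, x) and C(P_n, D), computed from an orthonormal basis [phi] of P_n. *)
Definition christoffel N (phi : 'I_N -> mpoly.mpoly d R) x : R :=
  \sum_k peval (phi k) x ^+ 2.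

Definition christoffel_sup N (phi : 'I_N -> mpoly.mpoly d R) D : \bar R :=
  ereal_sup [set (christoffel phi x)%:E | x in D].

End polynomials.

Section parallel_section.
Context {R : realType} {d : nat}.
Implicit Types (D : set 'rV[R]_d.+1) (xi : 'rV[R]_d.+1) (B : 'M[R]_(d, d.+1)).

(* The rows of [B] form an orthonormal basis of the orthogonal complement of
   [xi], so [y |-> s *: xi + y *m B] is an isometry of R^d onto the hyperplane
   [dotr x xi = s] when [xi] is a unit vector. *)
Definition orthonormal_frame xi B := B *m B^T = 1%:M /\ B *m xi^T = 0.

Definition support_min D xi : R := inf [set dotr x xi | x in D].

(* The section is measured in the coordinates given by [B]; its measure does
   not depend on the choice of the frame. *)
Definition parallel_section D xi B (t : R) : \bar R :=
  lebesgue_rV d [set y | D ((t + support_min D xi) *: xi + y *m B)].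

End parallel_section.

(* Main.v *)
Require Import Defs.
From mathcomp Require Import all_boot all_order all_algebra.
From mathcomp Require Import all_classical all_reals all_analysis.
From mathcomp Require Import measurable_realfun.
From mathcomp Require Import ring lra.
From mathcomp Require mpoly.
Import (canonicals, coercions) mpoly.

Set Implicit Arguments.
Unset Strict Implicit.
Unset Printing Implicit Defensive.
Import Order.TTheory GRing.Theory Num.Theory.
Import numFieldNormedType.Exports.
Local Open Scope classical_set_scope.
Local Open Scope ring_scope.

(** By the Cauchy-Schwarz inequality for coordinates in an orthonormal basis,
    [p(x) ^ 2 <= christoffel phi x * \int_D p ^ 2] for every [p] of degree at
    most [n] ([sqr_peval_le_christoffel]).  So it is enough to exhibit one
    polynomial which equals 1 at a point of [D] and has a small norm in [L_2(D)].

    The point [x0] is one where [D] touches its supporting hyperplane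
    orthogonal to [xi], and the polynomial is the ridge function
    [p(x) = q(dotr x xi - h)], [h = support_min D xi], where the univariate
    [q = peak L m (n %/ m)] is the [m]-th power of a normalized Dirichlet
    kernel transplanted to [[0, L]], [L] being at least the diameter.
    It satisfies [q(0) = 1] and, for [0 < t <= L], [q(t) ^ 2 <= 1] ([peak_le1])
    and [q(t) ^ 2 <= C n ^ (-2m) t ^ (-m)] ([peak_tail]).  Up to the constant [C]
    the two bounds cross at [t = n ^ (-2)], which is where the right-hand side of
    the theorem splits.

    Slicing [D] by the hyperplanes orthogonal to [xi] turns [\int_D p ^ 2] into
    [\int q(t) ^ 2 A(t) dt], with [A] the parallel section function
    ([integral_ridge]).  Since the Lebesgue measure is an iterated product
    along the coordinate axes, this is Fubini in a rotated frame and rests on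
    [ge0_integral_rV_orthogonal], the invariance of the Lebesgue integral under
    orthogonal maps.

    For the second part, when [lambda >= 0], a power bound on [A] is
    substituted in the two integrals ([section_energy_power_le]).  When
    [lambda < 0] that bound blows up at 0 and may fail to be integrable there;
    but sections of [D] have bounded volume, so the case [lambda = 0], [m = 2]
    gives the growth [n ^ 2], which is at least [n ^ (2 (1 + lambda))]. *)

(** * Reflections and translations of the Lebesgue integral *)

Section lebesgue_rV_invariance.
Context {R : realType}.
Local Notation mu := (@lebesgue_measure R).
Local Open Scope ereal_scope.

Lemma ge0_integral_reflect (a : R) (f : R -> \bar R) :
  measurable_fun setT f -> (forall t, 0 <= f t) ->
  \int[mu]_t f (a - t)%R = \int[mu]_t f t.
Proof.
move=> mf f0.
pose phi (t : measurableTypeR R) : measurableTypeR R := (a - t)%R.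
have mphi : measurable_fun setT phi by exact: measurable_funB.
transitivity (\int[pushforward mu phi]_t f t).
  by rewrite ge0_integral_pushforward// preimage_setT.
apply: eq_measure_integral => A mA _; apply/esym.
apply: lebesgue_measure_unique => //= _ [[u v]] _ <-.
rewrite /pushforward/=.
rewrite (_ : phi @^-1` _ = `[a - v, a - u[%classic)%R.
  rewrite !lebesgue_measure_itv/= !lte_fin ltrD2l ltrN2; case: ifP => // _.
  by rewrite -!EFinB; congr EFin; ring.
by apply/seteqP; split=> t /=; rewrite !in_itv/= /phi; lra.
Qed.

Lemma ge0_integral_rVS n (f : 'rV[R]_n.+1 -> \bar R) :
  measurable_fun setT f -> (forall x, 0 <= f x) ->
  \int[lebesgue_rV n.+1]_x f x =
  \int[mu]_t \int[lebesgue_rV n]_y f (cons_rV (t, y)).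
Proof.
move=> mf f0.
rewrite [LHS](ge0_integral_pushforward (@measurable_cons_rV R n))//=.
rewrite preimage_setT fubini_tonelli1//=.
  apply: measurableT_comp => //; exact: measurable_cons_rV.
Qed.

Lemma measurable_fun_integral_cons n (f : 'rV[R]_n.+1 -> \bar R) :
  measurable_fun setT f -> (forall x, 0 <= f x) ->
  measurable_fun setT (fun t => \int[lebesgue_rV n]_y f (cons_rV (t, y))).
Proof.
move=> mf f0.
apply: (@measurable_fun_fubini_tonelli_F _ _ _ _ _ (lebesgue_rV n)
  (f \o @cons_rV R n)) => //=.
  apply: measurableT_comp => //; exact: measurable_cons_rV.
Qed.

Lemma measurable_fun_addmx n d (T : measurableType d) (f g : T -> 'rV[R]_n) :
  measurable_fun setT f -> measurable_fun setT g ->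
  measurable_fun setT (fun x => f x + g x)%R.
Proof.
move=> mf mg; apply: measurable_fun_rVP => i; under eq_fun do rewrite mxE.
by apply: measurable_funD;
  [exact: measurableT_comp (measurable_coord_rV i) mf |
   exact: measurableT_comp (measurable_coord_rV i) mg].
Qed.

Lemma measurable_fun_oppmx n d (T : measurableType d) (f : T -> 'rV[R]_n) :
  measurable_fun setT f -> measurable_fun setT (fun x => - f x)%R.
Proof.
move=> mf; apply: measurable_fun_rVP => i; under eq_fun do rewrite mxE.
by apply: measurableT_comp => //; exact: measurableT_comp (measurable_coord_rV i) mf.
Qed.

Lemma measurable_fun_mulmxr n p (A : 'M[R]_(n, p)) d (T : measurableType d)
    (f : T -> 'rV[R]_n) :
  measurable_fun setT f -> measurable_fun setT (fun x => f x *m A)%R.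
Proof.
move=> mf; apply: measurable_fun_rVP => i; under eq_fun do rewrite mxE.
apply: measurable_sum => k; apply: measurable_funM => //.
exact: measurableT_comp (measurable_coord_rV k) mf.
Qed.

Lemma subr_cons_rV n (a : 'rV[R]_n.+1) t y :
  (a - cons_rV (t, y))%R = cons_rV (a ord0 ord0 - t, rsubmx (a : 'rV_(1 + n)) - y)%R.
Proof.
apply/rowP => i; rewrite /cons_rV /= !mxE.
case: (@fintype.splitP 1 n i) => j ij; rewrite !mxE /=.
  by congr (a _ _ - _)%R; apply/val_inj; rewrite /= ij ord1.
by congr (a _ _ - _)%R; apply/val_inj; rewrite /= ij.
Qed.

(** Reflections are the only symmetries that have to be checked coordinate by
    coordinate: each translation is a product of two of them. *)
Lemma ge0_integral_rV_reflect n (a : 'rV[R]_n) (f : 'rV[R]_n -> \bar R) :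
  measurable_fun setT f -> (forall x, 0 <= f x) ->
  \int[lebesgue_rV n]_x f (a - x)%R = \int[lebesgue_rV n]_x f x.
Proof.
elim: n a f => [|n IHn] a f mf f0.
  by apply: eq_integral => x _; congr f; apply/rowP => -[].
have mfa : measurable_fun setT (fun x : 'rV[R]_n.+1 => f (a - x)%R).
  apply: (measurableT_comp mf); apply: measurable_fun_addmx => //.
  exact: measurable_fun_oppmx.
rewrite !ge0_integral_rVS//.
transitivity (\int[mu]_t \int[lebesgue_rV n]_y f (cons_rV (a ord0 ord0 - t, y))%R).
  apply: eq_integral => t _.
  under eq_integral do rewrite subr_cons_rV.
  apply: (IHn _ (fun y => f (cons_rV (a ord0 ord0 - t, y)%R))) => //.
  apply: (measurableT_comp mf).
  apply: (measurableT_comp (@measurable_cons_rV R n)).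
  exact: measurable_fun_pair.
apply: (ge0_integral_reflect _ (f := fun t => \int[lebesgue_rV n]_y f (cons_rV (t, y)))).
  exact: measurable_fun_integral_cons.
by move=> t; apply: integral_ge0.
Qed.

Lemma ge0_integral_rV_translate n (a : 'rV[R]_n) (f : 'rV[R]_n -> \bar R) :
  measurable_fun setT f -> (forall x, 0 <= f x) ->
  \int[lebesgue_rV n]_x f (x + a)%R = \int[lebesgue_rV n]_x f x.
Proof.
move=> mf f0; rewrite -[RHS](ge0_integral_rV_reflect a)//.
rewrite -[RHS](ge0_integral_rV_reflect 0)//.
  by apply: eq_integral => x _; rewrite sub0r opprK addrC.
apply: (measurableT_comp mf); apply: measurable_fun_addmx => //.
exact: measurable_fun_oppmx.
Qed.

End lebesgue_rV_invariance.

(** * Orthogonal invariance of the Lebesgue integral *)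

Section lebesgue_rV_orthogonal.
Context {R : realType}.
Local Notation mu := (@lebesgue_measure R).

Definition box n (a : 'rV[R]_n) (r : R) : set 'rV[R]_n :=
  [set x | forall i, `|x ord0 i - a ord0 i| <= r].

Lemma measurable_box n (a : 'rV[R]_n) r : measurable (box a r).
Proof.
rewrite (_ : box a r = \bigcap_(i in [set: 'I_n])
    ((fun x : 'rV[R]_n => x ord0 i) @^-1` `[a ord0 i - r, a ord0 i + r]%classic)).
  apply: fin_bigcap_measurable => // i _.
  by rewrite -[X in measurable X]setTI; exact: measurable_coord_rV.
apply/seteqP; split=> x /= xar i; first move=> _.
  by have := xar i; rewrite ler_distl/= in_itv.
by have := xar i Logic.I; rewrite /= in_itv/= ler_distl.
Qed.

Lemma lebesgue_rV_box n (a : 'rV[R]_n) (r : R) : 0 <= r ->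
  lebesgue_rV n (box a r) = ((2 * r) ^+ n)%:E.
Proof.
move=> r0; elim: n a => [|n IHn] a.
  by rewrite /= /dirac indicE mem_set//= => -[].
rewrite /= /lebesgue_cons /pushforward.
have -> : @cons_rV R n @^-1` box a r =
    `[a ord0 ord0 - r, a ord0 ord0 + r]%classic `*` box (rsubmx (a : 'rV_(1 + n))) r.
  apply/seteqP; split=> -[t y] /=.
    move=> ta; split=> [|i] /=.
      have := ta ord0; rewrite /cons_rV mxE.
      case: (@fintype.splitP 1 n ord0) => // j _.
      by rewrite mxE/= in_itv/= ler_distl.
    have := ta (rshift 1 i); rewrite /cons_rV (@row_mxEr _ 1 1 n)/=.
    by rewrite mxE; congr (`|_ - a _ _| <= _); apply/val_inj.
  move=> [/= ta yb] i; rewrite /cons_rV mxE.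
  case: (@fintype.splitP 1 n i) => j ij; rewrite ?mxE /=.
    rewrite (_ : i = ord0) ?ler_distl; first by move: ta; rewrite in_itv.
    by apply/val_inj; rewrite /= ij ord1.
  have := yb j; rewrite mxE; congr (`|_ - a _ _| <= _); apply/val_inj.
  by rewrite /= ij.
rewrite product_measure1E//; last exact: measurable_box.
rewrite IHn [X in (X * _)%E](lebesgue_measure_itv
  `[a ord0 ord0 - r, a ord0 ord0 + r])/= lte_fin -EFinB.
case: ifPn => [_|]; first by rewrite -EFinM exprS; congr EFin; ring.
rewrite -leNgt => ltr; have -> : r = 0 by move: r0 ltr; lra.
by rewrite mul0e mulr0 expr0n.
Qed.

Lemma dotr_sum n (x y : 'rV[R]_n) : dotr x y = \sum_i x ord0 i * y ord0 i.
Proof. by rewrite /dotr mxE; under eq_bigr do rewrite mxE. Qed.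

Lemma measurable_fun_dotr n d (T : measurableType d) (f g : T -> 'rV[R]_n) :
  measurable_fun setT f -> measurable_fun setT g ->
  measurable_fun setT (fun x => dotr (f x) (g x)).
Proof.
move=> mf mg; under eq_fun do rewrite dotr_sum.
apply: measurable_sum => k; apply: measurable_funM => //.
  exact: measurableT_comp (measurable_coord_rV k) mf.
exact: measurableT_comp (measurable_coord_rV k) mg.
Qed.

Definition unit_ball n : set 'rV[R]_n := [set x | dotr x x <= 1].

Lemma measurable_unit_ball n : measurable (@unit_ball n).
Proof.
rewrite (_ : @unit_ball n = (fun x : 'rV[R]_n => dotr x x) @^-1` `]-oo, 1]%classic).
  rewrite -[X in measurable X]setTI; apply: measurable_fun_dotr => //.
by apply/seteqP; split=> x /=; rewrite in_itv.
Qed.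

Lemma sqr_coord_le_dotr n (x : 'rV[R]_n) i : x ord0 i ^+ 2 <= dotr x x.
Proof.
rewrite dotr_sum (bigD1 i)//= expr2 lerDl.
by apply: sumr_ge0 => j _; rewrite -expr2 sqr_ge0.
Qed.

(** The ball lies between two cubes.  A positive and finite volume is what makes
    it possible to cancel the ball in [ge0_integral_rV_orthogonal]. *)
Lemma lebesgue_rV_unit_ball n :
  exists2 c : R, 0 < c & lebesgue_rV n (@unit_ball n) = c%:E.
Proof.
have mB := @measurable_unit_ball n; pose r : R := n.+1%:R^-1.
have r0 : 0 < r by rewrite invr_gt0.
have lo : (((2 * r) ^+ n)%:E <= lebesgue_rV n (@unit_ball n))%E.
  rewrite -(lebesgue_rV_box 0 (ltW r0)).
  apply: le_measure; rewrite ?inE//; first exact: measurable_box.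
  move=> x xr; rewrite /unit_ball/= dotr_sum.
  apply: (@le_trans _ _ (\sum_(i < n) r)).
    apply: ler_sum => i _; have := xr i; rewrite mxE subr0 => xi.
    rewrite -expr2 -real_normK ?num_real// expr2.
    rewrite -[leRHS]mulr1; apply: ler_pM => //; apply: (le_trans xi).
    by rewrite invf_le1 ?ler1n.
  rewrite sumr_const card_ord -mulr_natr mulrC ler_pdivrMr//.
  by rewrite mul1r ler_nat.
have hi : (lebesgue_rV n (@unit_ball n) <= ((2 * 1) ^+ n)%:E)%E.
  rewrite -(lebesgue_rV_box (0 : 'rV[R]_n) ler01).
  apply: le_measure; rewrite ?inE//; first exact: measurable_box.
  move=> x x1 i; rewrite mxE subr0 -(@ler_pXn2r _ 2) ?nnegrE// expr1n.
  by rewrite real_normK ?num_real// (le_trans (sqr_coord_le_dotr x i)).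
have fB : lebesgue_rV n (@unit_ball n) \is a fin_num.
  by rewrite ge0_fin_numE ?measure_ge0// (le_lt_trans hi)// ltry.
exists (fine (lebesgue_rV n (@unit_ball n))); last by rewrite fineK.
rewrite -lte_fin fineK//; apply: lt_le_trans lo.
by rewrite lte_fin exprn_gt0 ?mulr_gt0.
Qed.

(** The uniqueness of the translation-invariant measure, in integrated form.
    With [g] the indicator of the unit ball, Fubini and translations give
    [(\int f (x Q) dx) * (\int g) = \int \int f (x Q) g (x Q - y) dx dy
     = \int \int f (x Q + y) g (x Q) dx dy = (\int g (x Q) dx) * (\int f)],
    and [g (x Q) = g x]. *)
Lemma ge0_integral_rV_orthogonal n (Q : 'M[R]_n) (f : 'rV[R]_n -> \bar R) :
  Q *m Q^T = 1%:M -> measurable_fun setT f -> (forall x, 0 <= f x)%E ->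
  (\int[lebesgue_rV n]_x f (x *m Q) = \int[lebesgue_rV n]_x f x)%E.
Proof.
move=> QQT mf f0; have QTQ := mulmx1C QQT.
have [c c0 cE] := lebesgue_rV_unit_ball n.
pose g (x : 'rV[R]_n) : \bar R := (\1_(@unit_ball n) x)%:E.
have g0 x : (0 <= g x)%E by rewrite lee_fin.
have mg : measurable_fun setT g.
  by apply/measurable_EFinP; apply: measurable_indic; exact: measurable_unit_ball.
have gE : (\int[lebesgue_rV n]_x g x = c%:E)%E.
  by rewrite integral_indic ?setIT//; exact: measurable_unit_ball.
have gQ x : g (x *m Q) = g x.
  rewrite /g !indicE; congr (_%:R%:E).
  have -> : (x *m Q \in @unit_ball n) = (x \in @unit_ball n); last by [].
  suff dQ : dotr (x *m Q) (x *m Q) = dotr x x.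
    by apply/idP/idP; rewrite !inE /unit_ball/= dQ.
  by rewrite /dotr trmx_mul mulmxA -(mulmxA x) QQT mulmx1.
suff fc : (\int[lebesgue_rV n]_x f (x *m Q)%R * c%:E
           = \int[lebesgue_rV n]_x f x * c%:E)%E.
  have c1 : (c%:E * (c^-1)%:E = 1)%E by rewrite -EFinM mulfV ?gt_eqF.
  by rewrite -[LHS]mule1 -[RHS]mule1 -c1 !muleA fc.
have mfQ : measurable_fun setT (fun x : 'rV[R]_n => f (x *m Q)).
  by apply: (measurableT_comp mf); exact: measurable_fun_mulmxr.
have mgQ : measurable_fun setT (fun x : 'rV[R]_n => g (x *m Q)).
  by apply: (measurableT_comp mg); exact: measurable_fun_mulmxr.
transitivity (\int[lebesgue_rV n]_x \int[lebesgue_rV n]_y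
    (f (x *m Q)%R * g (x *m Q - y)%R))%E.
  rewrite -ge0_integralZr//; last by rewrite lee_fin ltW.
  apply: eq_integral => x _; rewrite ge0_integralZl//.
  - by rewrite ge0_integral_rV_reflect// gE.
  - apply: (measurableT_comp mg); apply: measurable_fun_addmx => //.
    exact: measurable_fun_oppmx.
pose F (p : 'rV[R]_n * 'rV[R]_n) := (f (p.1 *m Q)%R * g (p.1 *m Q - p.2)%R)%E.
have mF : measurable_fun setT F.
  apply: emeasurable_funM.
    exact: (measurableT_comp mfQ measurable_fst).
  apply: (measurableT_comp mg); apply: measurable_fun_addmx.
    by apply: measurable_fun_mulmxr; exact: measurable_fst.
  by apply: measurable_fun_oppmx; exact: measurable_snd.
rewrite (fubini_tonelli F)//; last by move=> p; apply: mule_ge0.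
transitivity (\int[lebesgue_rV n]_y \int[lebesgue_rV n]_x
    (f (x *m Q + y)%R * g (x *m Q)%R))%E.
  apply: eq_integral => y _.
  (* This translation of [x] adds [y] to [x *m Q]. *)
  rewrite -(ge0_integral_rV_translate (y *m Q^T) (f := fun x => F (x, y))).
  - apply: eq_integral => x _.
    by rewrite /F/= mulmxDl -mulmxA QTQ mulmx1 addrK.
  - by apply: (measurableT_comp mF); exact: measurable_fun_pair.
  - by move=> x; apply: mule_ge0.
pose G (p : 'rV[R]_n * 'rV[R]_n) := (f (p.1 *m Q + p.2)%R * g (p.1 *m Q)%R)%E.
have mG : measurable_fun setT G.
  apply: emeasurable_funM.
    apply: (measurableT_comp mf); apply: measurable_fun_addmx.
      by apply: measurable_fun_mulmxr; exact: measurable_fst.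
    exact: measurable_snd.
  exact: (measurableT_comp mgQ measurable_fst).
rewrite -(fubini_tonelli G)//; last by move=> p; apply: mule_ge0.
rewrite -gE -ge0_integralZl//; last exact: integral_ge0.
apply: eq_integral => x _; rewrite /G/= gQ ge0_integralZr//; last first.
  by apply: (measurableT_comp mf); exact: measurable_fun_addmx.
congr (_ * _)%E; rewrite -[RHS](ge0_integral_rV_translate (x *m Q))//.
by apply: eq_integral => y _; rewrite addrC.
Qed.

End lebesgue_rV_orthogonal.

(** * Closed sets are Borel *)

Section measurability.
Context {R : realType}.

(** The sigma-algebra is generated by the coordinates, so open sets have to be
    reached through countably many boxes: a closed set is the intersection over
    [k] of the union of the cubes of half-side [1 / (k + 1)], centred at rational
    points, that meet it. *)
Lemma closed_measurable_rV n (D : set 'rV[R]_n) : closed D -> measurable D.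
Proof.
move=> cD; pose r k : R := k.+1%:R^-1; have r0 k : 0 < r k by rewrite invr_gt0.
pose q_ (q : 'rV[rat]_n) : 'rV[R]_n := map_mx ratr q.
pose near_D k q := exists2 y, D y & box (q_ q) (r k) y.
have -> : D = \bigcap_k \bigcup_(q in [set q | near_D k q]) box (q_ q) (r k).
  apply/seteqP; split=> [x Dx k _|x xD].
    have qx i : {q : rat | x ord0 i - r k < ratr q < x ord0 i + r k}.
      apply: cid; have [|q qr] := @rat_in_itvoo R (x ord0 i - r k) (x ord0 i + r k).
        by rewrite ltrD2l (lt_trans _ (r0 k))// oppr_lt0.
      by exists q; move: qr; rewrite in_itv.
    have xq : box (q_ (\row_i projT1 (qx i))) (r k) x.
      move=> i; rewrite !mxE; case: (qx i) => q /= qr.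
      by rewrite distrC ltW// ltr_distl.
    by exists (\row_i projT1 (qx i)) => //; exists x.
  apply: cD => B /nbhs_ballP[e /= e0 eB].
  have [k ke] : exists k, r k + r k < e.
    have [k _ ke] := near_infty_natSinv_lt (PosNum (divr_gt0 e0 (ltr0Sn _ 1))).
    by exists k; rewrite (splitr e); apply: ltrD; exact: (ke k (leqnn k)).
  have [q [y Dy yq] xq] := xD k Logic.I.
  exists y; split=> //; apply: eB; split=> // i j; rewrite ord1.
  apply: le_lt_trans ke; rewrite -(subrKA (q_ q ord0 j)).
  by apply: (le_trans (ler_normD _ _)); apply: lerD; [|rewrite distrC].
apply: bigcapT_measurable => k; rewrite bigcup_mkcond.
apply: countable_bigcupT_measurable => // q; case: ifP => _ //.
exact: measurable_box.
Qed.

End measurability.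

(** * Univariate polynomials peaking at an endpoint *)

Section kernel.
Variable R : realFieldType.

(** With [s = sin(phi) ^ 2], the values at [s] of the two components are
    [sin((2k+1) phi) / sin(phi)] and [cos((2k+1) phi) / cos(phi)]; the recurrence
    is the addition formula for a rotation by [2 phi].  The first component is
    the Dirichlet kernel. *)
Fixpoint dirichlet_pair (k : nat) : {poly R} * {poly R} :=
  if k is k'.+1 then
    let: (W, V) := dirichlet_pair k' in
    ((1 - 2%:P * 'X) * W + (2%:P - 2%:P * 'X) * V,
     (1 - 2%:P * 'X) * V - 2%:P * 'X * W)
  else (1, 1).

Lemma size_dirichlet_pair k :
  (size (dirichlet_pair k).1 <= k.+1)%N /\ (size (dirichlet_pair k).2 <= k.+1)%N.
Proof.
elim: k => [|k]; first by rewrite /= size_poly1.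
rewrite /=; case: (dirichlet_pair k) => W V /= [sW sV].
have sX : (size (2%:P * 'X : {poly R})%R <= 2)%N.
  by rewrite (leq_trans (size_polyMleq _ _))// size_polyX addn2/= ltnS size_polyC leq_b1.
have s1 (c : R) : (size (c%:P - 2%:P * 'X : {poly R})%R <= 2)%N.
  rewrite (leq_trans (size_polyD _ _))// geq_max size_polyN sX andbT.
  by rewrite size_polyC (leq_trans (leq_b1 _)).
have sM (p q : {poly R}) :
    (size p <= 2)%N -> (size q <= k.+1)%N -> (size (p * q)%R <= k.+2)%N.
  move=> p2 qk; rewrite (leq_trans (size_polyMleq _ _))//.
  by rewrite -subn1 leq_subLR; exact: (leq_add p2 qk).
split; rewrite (leq_trans (size_polyD _ _))// geq_max ?size_polyN;
  apply/andP; split; apply: sM => //.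
- exact: (s1 1).
- exact: (s1 1).
Qed.

Lemma dirichlet_pair_hornerS k s :
  let w := (dirichlet_pair k).1.[s] in let v := (dirichlet_pair k).2.[s] in
  (dirichlet_pair k.+1).1.[s] = (1 - 2 * s) * w + (2 - 2 * s) * v /\
  (dirichlet_pair k.+1).2.[s] = (1 - 2 * s) * v - 2 * s * w.
Proof. by rewrite /=; case: (dirichlet_pair k) => W V /=; rewrite !hornerE. Qed.

(** The identity [sin ^ 2 + cos ^ 2 = 1] for the angle [(2k+1) phi]. *)
Lemma dirichlet_pair_pythagoras k s :
  s * (dirichlet_pair k).1.[s] ^+ 2 + (1 - s) * (dirichlet_pair k).2.[s] ^+ 2 = 1.
Proof.
elim: k => [|k IHk]; first by rewrite [dirichlet_pair 0]/= hornerC; ring.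
by have [-> ->] := dirichlet_pair_hornerS k s; rewrite -[RHS]IHk; ring.
Qed.

Lemma dirichlet_pair_at0 k :
  (dirichlet_pair k).1.[0] = (2 * k).+1%:R /\ (dirichlet_pair k).2.[0] = 1.
Proof.
elim: k => [|k [W0 V0]]; first by rewrite [dirichlet_pair 0]/= hornerC.
have [-> ->] := dirichlet_pair_hornerS k 0; rewrite W0 V0; split; last by ring.
by rewrite mulnS -addnS natrD; ring.
Qed.

(** Consecutive kernels differ by twice [(1 - s) a - s b], which is
    [cos(2 (k+1) phi)], hence bounded by 1; here this follows from the Pythagorean
    identity. *)
Lemma dirichlet_pair_norm_le k s : 0 <= s <= 1 ->
  `|(dirichlet_pair k).1.[s]| <= (2 * k).+1%:R.
Proof.
move=> s01; elim: k => [|k IHk]; first by rewrite [dirichlet_pair 0]/= hornerC normr1.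
have [-> _] := dirichlet_pair_hornerS k s.
have := dirichlet_pair_pythagoras k s.
move: IHk; set b := _.1.[s]; set a := _.2.[s] => IHk pyth.
have -> : (1 - 2 * s) * b + (2 - 2 * s) * a = 2 * ((1 - s) * a - s * b) + b by ring.
apply: (le_trans (ler_normD _ _)); rewrite mulnS -addnS natrD; apply: lerD => //.
rewrite normrM normr_nat -[leRHS]mulr1 ler_pM2l//.
rewrite ler_norml; move: s01 => /andP[s0 s1].
have : ((1 - s) * a - s * b) ^+ 2 <= 1.
  have -> : ((1 - s) * a - s * b) ^+ 2 =
    (s * b ^+ 2 + (1 - s) * a ^+ 2) - s * (1 - s) * (a + b) ^+ 2 by ring.
  by rewrite pyth lerBlDr lerDl mulr_ge0 ?sqr_ge0// mulr_ge0// subr_ge0.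
by move=> h; apply/andP; split; nra.
Qed.

(** The [m]-th power gives the decay [t ^ (-m)] of the square, because the square
    of one kernel decays like [1 / t]. *)
Definition peak (L : R) (m k : nat) : {poly R} :=
  ((2 * k).+1%:R^-1 *: ((dirichlet_pair k).1 \Po (L^-1 *: 'X))) ^+ m.

Lemma size_peak L m k : (size (peak L m k) <= (m * k).+1)%N.
Proof.
rewrite (leq_trans (size_poly_exp_leq _ _))// ltnS mulnC leq_mul2l; apply/orP; right.
rewrite -subn1 leq_subLR add1n (leq_trans (size_scale_leq _ _))//.
rewrite (leq_trans (size_comp_poly_leq _ _))// ltnS -[leqRHS]muln1.
apply: leq_mul; rewrite -subn1 leq_subLR add1n; first exact: (size_dirichlet_pair k).1.
by rewrite (leq_trans (size_scale_leq _ _))// size_polyX.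
Qed.

Lemma horner_peak L m k t :
  (peak L m k).[t] = ((2 * k).+1%:R^-1 * (dirichlet_pair k).1.[L^-1 * t]) ^+ m.
Proof. by rewrite horner_exp hornerZ horner_comp hornerZ hornerX. Qed.

Lemma peak0 L m k : (peak L m k).[0] = 1.
Proof.
rewrite horner_peak mulr0.
by rewrite (dirichlet_pair_at0 k).1 mulVf ?expr1n// pnatr_eq0.
Qed.

Lemma rescale_itv01 (L t : R) : 0 < L -> 0 <= t <= L -> 0 <= L^-1 * t <= 1.
Proof.
move=> L0 /andP[t0 tL]; rewrite ler_pdivrMl// mulr1 tL andbT.
by rewrite mulr_ge0// invr_ge0 ltW.
Qed.

Lemma peak_le1 L m k t : 0 < L -> 0 <= t <= L -> (peak L m k).[t] ^+ 2 <= 1.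
Proof.
move=> L0 tL; rewrite horner_peak exprAC exprn_ile1 ?sqr_ge0//.
rewrite -real_normK ?num_real// exprn_ile1// normrM ger0_norm ?invr_ge0//.
by rewrite ler_pdivrMl// mulr1 dirichlet_pair_norm_le// rescale_itv01.
Qed.

Lemma peak_decay L m k t : 0 < L -> 0 <= t <= L ->
  (peak L m k).[t] ^+ 2 * ((2 * k).+1%:R ^+ 2 * t) ^+ m <= L ^+ m.
Proof.
move=> L0 tL; rewrite horner_peak exprAC -exprMn.
set w := (dirichlet_pair k).1.[_]; set c : R := _.+1%:R.
have : c != 0 by rewrite pnatr_eq0.
clearbody c => c0.
have -> : (c^-1 * w) ^+ 2 * (c ^+ 2 * t) = L * (L^-1 * t * w ^+ 2).
  by field; rewrite (gt_eqF L0) c0.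
have /andP[s0 s1] := rescale_itv01 L0 tL.
apply: lerXn2r; rewrite ?nnegrE; [|exact: ltW|].
  by apply: mulr_ge0; [exact: ltW|rewrite mulr_ge0 ?sqr_ge0].
rewrite -[leRHS]mulr1 ler_pM2l// -(dirichlet_pair_pythagoras k (L^-1 * t)).
by rewrite lerDl mulr_ge0 ?sqr_ge0// subr_ge0.
Qed.

(** With [k = n %/ m] the degree [m * k] is at most [n], while [2k + 1 >= n / m]
    keeps the decay at the scale [n ^ (-2)]. *)
Lemma peak_tail L m n t : (0 < m)%N -> (0 < n)%N -> 0 < t <= L ->
  (peak L m (n %/ m)).[t] ^+ 2 <= (m%:R ^+ 2 * L) ^+ m * (n%:R ^- (2 * m) * t ^- m).
Proof.
move=> m0 n0 /andP[t0 tL]; have L0 := lt_le_trans t0 tL.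
set k := (n %/ m)%N; set q2 := _ ^+ 2.
have nk : n%:R <= (2 * k).+1%:R * m%:R :> R.
  rewrite -natrM ler_nat (leq_trans (ltnW (ltn_ceil n m0)))// -/k.
  by rewrite leq_mul2r ltnS leq_pmull ?orbT.
have n0' : 0 < n%:R :> R by rewrite ltr0n.
rewrite -invfM exprM -exprMn ler_pdivlMr; last by rewrite exprn_gt0// mulr_gt0// exprn_gt0.
apply: (@le_trans _ _ (q2 * ((2 * k).+1%:R ^+ 2 * t) ^+ m * (m%:R ^+ 2) ^+ m)).
  have nkt : n%:R ^+ 2 * t <= (2 * k).+1%:R ^+ 2 * t * m%:R ^+ 2.
    rewrite [leRHS]mulrAC -exprMn; apply: ler_wpM2r; first exact: ltW.
    by apply: lerXn2r; rewrite ?nnegrE ?ler0n// mulr_ge0 ?ler0n.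
  rewrite -mulrA -exprMn; apply: ler_wpM2l; first exact: sqr_ge0.
  apply: lerXn2r nkt; rewrite nnegrE.
    by rewrite mulr_ge0 ?sqr_ge0// ltW.
  by rewrite !mulr_ge0 ?sqr_ge0// ltW.
rewrite [leRHS]exprMn [leLHS]mulrC; apply: ler_wpM2l.
  by rewrite exprn_ge0// sqr_ge0.
by apply: peak_decay => //; rewrite tL ltW.
Qed.
End kernel.

(** * Ridge polynomials and the Christoffel function *)

Section ridge.
Context {R : realType}.
Local Notation mu := (@lebesgue_measure R).

(** The degree of a product in the form convenient for upper bounds, where zero
    polynomials need no special treatment. *)
Lemma msizeM_deg d (p q : mpoly.mpoly d R) a b :
  (mpoly.msize p <= a.+1)%N -> (mpoly.msize q <= b.+1)%N ->
  (mpoly.msize (p * q)%R <= (a + b).+1)%N.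
Proof.
have [->|p0] := eqVneq p 0; first by rewrite mul0r mpoly.mmeasure0.
have [->|q0] := eqVneq q 0; first by rewrite mulr0 mpoly.mmeasure0.
move=> pa qb; rewrite mpoly.msizeM// -subn1 leq_subLR add1n.
by rewrite (leq_trans (leq_add pa qb))// addSn addnS.
Qed.

Lemma ridge_polynomial d n (q : {poly R}) (xi : 'rV[R]_d) (h : R) :
  (size q <= n.+1)%N ->
  exists2 p : mpoly.mpoly d R, polys n p &
    forall x, peval p x = q.[dotr x xi - h].
Proof.
move=> qn.
pose ell : mpoly.mpoly d R :=
  \sum_i xi ord0 i *: mpoly.mpolyX R (mpoly.mnm1 i) - mpoly.mpolyC d h.
have ell1 : (mpoly.msize ell <= 2)%N.
  rewrite (leq_trans (mpoly.msizeD_le _ _))// geq_max mpoly.mmeasureN.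
  rewrite mpoly.mmeasureC (leq_trans (leq_b1 _))// andbT.
  rewrite (leq_trans (mpoly.msize_sum _ _ _))//.
  apply/bigmax_leqP => i _; rewrite (leq_trans (mpoly.mmeasureZ_le _ _ _))//.
  by rewrite mpoly.mmeasureX /= mpoly.mdeg1.
have ellX i : (mpoly.msize (ell ^+ i)%R <= i.+1)%N.
  elim: i => [|i IHi]; first by rewrite expr0 mpoly.mmeasure1.
  by rewrite exprS; apply: (msizeM_deg ell1 IHi).
exists (\sum_(i < size q) q`_i *: ell ^+ i).
  rewrite /polys/= (leq_trans (mpoly.msize_sum _ _ _))//.
  apply/bigmax_leqP => i _; rewrite (leq_trans (mpoly.mmeasureZ_le _ _ _))//.
  by rewrite (leq_trans (ellX i))// (leq_trans (ltn_ord i)).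
move=> x; rewrite /peval raddf_sum horner_coef; apply: eq_bigr => i _.
rewrite /= mpoly.mevalZ rmorphXn/= /ell mpoly.mevalB mpoly.mevalC raddf_sum.
congr (_ * (_ - _) ^+ _); rewrite dotr_sum; apply: eq_bigr => j _.
by rewrite /= mpoly.mevalZ mpoly.mevalXU mulrC.
Qed.

Lemma measurable_peval d (p : mpoly.mpoly d R) : measurable_fun setT (peval p).
Proof.
rewrite /peval; under eq_fun do rewrite mpoly.mevalE.
apply: measurable_sum => m; apply: measurable_funM => //.
apply: measurable_prod => i _; apply: measurable_funX.
exact: measurable_coord_rV.
Qed.

(** Cauchy-Schwarz, from expanding the sum of the squares of
    [b i * A - a i * S], where [A] and [S] are the sums of the [a i ^+ 2] and of
    the [a i * b i]. *)
Lemma sqr_sum_le_mul (I : finType) (a b : I -> R) :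
  (\sum_i a i * b i) ^+ 2 <= (\sum_i a i ^+ 2) * (\sum_i b i ^+ 2).
Proof.
set S := \sum_i a i * b i; set A := \sum_i _; set B := \sum_i _.
have A0 : 0 <= A by apply: sumr_ge0 => i _; exact: sqr_ge0.
have [AE|An0] := eqVneq A 0.
  have a0 i : a i = 0.
    apply/eqP; rewrite -sqrf_eq0; apply/eqP.
    move/eqP: AE; rewrite psumr_eq0 => [/allP/(_ i)|j _]; rewrite ?sqr_ge0//.
    by rewrite mem_index_enum => /(_ isT)/eqP.
  by rewrite /S big1 ?expr0n ?AE ?mul0r// => i _; rewrite a0 mul0r.
have Apos : 0 < A by rewrite lt_def An0.
have : 0 <= \sum_i (b i * A - a i * S) ^+ 2 by apply: sumr_ge0 => i _; exact: sqr_ge0.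
have -> : \sum_i (b i * A - a i * S) ^+ 2 = A * (A * B - S ^+ 2).
  transitivity (A ^+ 2 * B - 2 * (A * S) * S + S ^+ 2 * A); last by ring.
  rewrite [A ^+ 2 * B]mulr_sumr [2 * (A * S) * S]mulr_sumr [S ^+ 2 * A]mulr_sumr.
  rewrite -sumrB -big_split; by apply: eq_bigr => i _ /=; ring.
by rewrite pmulr_rge0// subr_ge0.
Qed.

Lemma sqr_dotr_le d (x y : 'rV[R]_d) : dotr x y ^+ 2 <= dotr x x * dotr y y.
Proof. by rewrite !dotr_sum; exact: sqr_sum_le_mul. Qed.

(** In the coordinates [a] of [p], the integral of [p ^ 2] is the sum of the
    [a k ^+ 2] by orthonormality, and [p x] is the sum of the
    [a k * peval (phi k) x]. *)
Lemma sqr_peval_le_christoffel d (D : set 'rV[R]_d) n N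
    (phi : 'I_N -> mpoly.mpoly d R) p x :
  measurable D -> orthonormal_basis D n phi -> polys n p ->
  (((peval p x) ^+ 2)%:E <=
   (\int[lebesgue_rV d]_(y in D) (peval p y ^+ 2)%:E) * (christoffel phi x)%:E)%E.
Proof.
move=> mD [-> ortho] [a _ <-].
have pE y : peval (\sum_k a k *: phi k) y = \sum_k a k * peval (phi k) y.
  by rewrite /peval raddf_sum; apply: eq_bigr => k _; rewrite /= mpoly.mevalZ.
have mphi k : measurable_fun D (peval (phi k)).
  by apply: measurable_funTS; exact: measurable_peval.
have isqr k : (lebesgue_rV d).-integrable D (fun y => (peval (phi k) y ^+ 2)%:E).
  apply/integrableP; split; first by apply/measurable_EFinP; exact: measurable_funX.
  under eq_integral do rewrite gee0_abs ?lee_fin ?sqr_ge0// expr2.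
  by rewrite ortho ltry.
(* Products are dominated by the sum of the squares. *)
have imul j k : (lebesgue_rV d).-integrable D
    (fun y => (peval (phi j) y * peval (phi k) y)%:E).
  apply: (le_integrable mD _ _ (integrableD mD (isqr j) (isqr k))).
    by apply/measurable_EFinP; exact: measurable_funM.
  move=> y _ /=; rewrite lee_fin [leRHS]ger0_norm ?addr_ge0 ?sqr_ge0// ler_norml.
  by apply/andP; split; nra.
have -> : (\int[lebesgue_rV d]_(y in D) (peval (\sum_k a k *: phi k) y ^+ 2)%:E =
    (\sum_k a k ^+ 2)%:E)%E.
  transitivity (\int[lebesgue_rV d]_(y in D) (\sum_j \sum_k
      ((a j * a k)%:E * (peval (phi j) y * peval (phi k) y)%:E)))%E.
    apply: eq_integral => y _; rewrite pE expr2 mulr_suml.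
    rewrite -sumEFin; apply: eq_bigr => j _.
    rewrite mulr_sumr -sumEFin; apply: eq_bigr => k _.
    by rewrite -EFinM; congr EFin; ring.
  rewrite integral_sum//; last first.
    by move=> j; apply: integrable_sum => // k _; exact: integrableZl.
  rewrite -sumEFin; apply: eq_bigr => j _.
  rewrite integral_sum//; last by move=> k; exact: integrableZl.
  rewrite (bigD1 j)//= big1 ?adde0 => [|k kj].
    by rewrite integralZl// ortho eqxx mule1 expr2.
  by rewrite integralZl// ortho eq_sym (negbTE kj) mule0.
rewrite pE -EFinM lee_fin; exact: sqr_sum_le_mul.
Qed.

End ridge.

(** * Slicing by parallel hyperplanes *)

Section sections.
Context {R : realType} {d : nat}.
Local Notation mu := (@lebesgue_measure R).
Implicit Types (D : set 'rV[R]_d.+1) (xi : 'rV[R]_d.+1) (B : 'M[R]_(d, d.+1)).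

(** The orthogonal change of frame that sends the first coordinate axis to the
    line spanned by [xi]. *)
Definition frame_mx xi B : 'M[R]_d.+1 := (col_mx xi B : 'M[R]_(1 + d, d.+1)).

Lemma enorm1P xi : enorm xi = 1 -> dotr xi xi = 1.
Proof.
rewrite /enorm => x1; have [x0|x0] := leP 0 (dotr xi xi).
  by rewrite -(sqr_sqrtr x0) x1 expr1n.
by move: x1; rewrite ler0_sqrtr ?(ltW x0)// => /eqP; rewrite eq_sym oner_eq0.
Qed.

Lemma orthogonal_frame_mx xi B : dotr xi xi = 1 -> orthonormal_frame xi B ->
  frame_mx xi B *m (frame_mx xi B)^T = 1%:M.
Proof.
move=> xi1 [BB Bxi]; rewrite /frame_mx (@tr_col_mx _ 1 d) (@mul_col_row _ 1 d _ 1 d).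
have -> : xi *m xi^T = 1%:M.
  by apply/matrixP => i j; rewrite !ord1 -[LHS]/(dotr xi xi) xi1 mxE eqxx.
have -> : xi *m B^T = 0 by rewrite -[LHS]trmxK trmx_mul trmxK Bxi trmx0.
by rewrite BB Bxi -(@scalar_mx_block _ 1 d).
Qed.

Lemma cons_rV_frame_mx xi B t y :
  cons_rV (t, y) *m frame_mx xi B = t *: xi + y *m B.
Proof.
rewrite /cons_rV /frame_mx /= (@mul_row_col _ 1 1 d); congr (_ + _).
by apply/matrixP => i j; rewrite !ord1 !mxE big_ord1 mxE.
Qed.

Lemma dotr_frame xi B t y : dotr xi xi = 1 -> orthonormal_frame xi B ->
  dotr (t *: xi + y *m B) xi = t.
Proof.
move=> xi1 [_ Bxi]; rewrite /dotr mulmxDl -scalemxAl -mulmxA Bxi mulmx0 addr0 mxE.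
by rewrite -/(dotr xi xi) xi1 mulr1.
Qed.

(** The section at absolute height [t], whereas [parallel_section] counts heights
    from [support_min]. *)
Definition slice D xi B (t : R) : set 'rV[R]_d := [set y | D (t *: xi + y *m B)].

Lemma measurable_slice D xi B t : measurable D -> measurable (slice D xi B t).
Proof.
move=> mD; rewrite (_ : slice _ _ _ _ = (fun y => t *: xi + y *m B) @^-1` D)//.
rewrite -[X in measurable X]setTI.
suff: measurable_fun setT (fun y : 'rV[R]_d => t *: xi + y *m B) by exact.
by apply: measurable_fun_addmx => //; exact: measurable_fun_mulmxr.
Qed.

Lemma measurable_fun_slice D xi B : measurable D ->
  measurable_fun setT (fun t => lebesgue_rV d (slice D xi B t)).
Proof.
move=> mD; pose I (x : 'rV[R]_d.+1) : \bar R := (\1_D x)%:E.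
have mI : measurable_fun setT I by apply/measurable_EFinP; exact: measurable_indic.
have mIQ : measurable_fun setT (fun x : 'rV[R]_d.+1 => I (x *m frame_mx xi B)).
  by apply: (measurableT_comp mI); exact: measurable_fun_mulmxr.
have := measurable_fun_integral_cons mIQ (fun x => ltac:(by rewrite lee_fin)).
apply: eq_measurable_fun => t _; rewrite -(setIT (slice D xi B t)) -integral_indic//.
  by apply: eq_integral => y _; rewrite cons_rV_frame_mx.
exact: measurable_slice.
Qed.

Lemma measurable_parallel_section D xi B : measurable D ->
  measurable_fun setT (parallel_section D xi B).
Proof.
move=> mD; apply: (measurableT_comp (measurable_fun_slice xi B mD)).
exact: measurable_funD.
Qed.

(** Fubini in the frame [(xi, B)]: on each hyperplane orthogonal to [xi] the
    integrand is a constant times the indicator of the slice. *)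
Lemma integral_ridge D xi B (F : R -> \bar R) :
  measurable D -> dotr xi xi = 1 -> orthonormal_frame xi B ->
  measurable_fun setT F -> (forall t, 0 <= F t)%E ->
  (\int[lebesgue_rV d.+1]_(x in D) F (dotr x xi - support_min D xi)%R
   = \int[mu]_t (F t * parallel_section D xi B t))%E.
Proof.
move=> mD xi1 fr mF F0; set h := support_min D xi.
pose H (x : 'rV[R]_d.+1) := (F (dotr x xi - h)%R * (\1_D x)%:E)%E.
have mH : measurable_fun setT H.
  apply: emeasurable_funM; last by apply/measurable_EFinP; exact: measurable_indic.
  apply: (measurableT_comp mF); apply: measurable_funB => //.
  exact: measurable_fun_dotr.
have H0 x : (0 <= H x)%E by apply: mule_ge0 => //; rewrite lee_fin.
rewrite integral_mkcond; transitivity (\int[lebesgue_rV d.+1]_x H x)%E.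
  apply: eq_integral => x _; rewrite /H patchE indicE; case: ifPn => _; first by rewrite mule1.
  by rewrite mule0.
rewrite -(ge0_integral_rV_orthogonal (orthogonal_frame_mx xi1 fr))//.
rewrite ge0_integral_rVS//; last first.
  by apply: (measurableT_comp mH); exact: measurable_fun_mulmxr.
transitivity (\int[mu]_t (F (t - h)%R * lebesgue_rV d (slice D xi B t)))%E.
  apply: eq_integral => t _.
  transitivity (\int[lebesgue_rV d]_y (F (t - h)%R * (\1_(slice D xi B t) y)%:E))%E.
    by apply: eq_integral => y _; rewrite cons_rV_frame_mx /H dotr_frame.
  rewrite ge0_integralZl//; last first.
    by apply/measurable_EFinP/measurable_indic; exact: measurable_slice.
  by rewrite integral_indic ?setIT//; exact: measurable_slice.
pose G t := (F t * parallel_section D xi B t)%E.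
have mG : measurable_fun setT G.
  by apply: emeasurable_funM => //; exact: measurable_parallel_section.
have G0 t : (0 <= G t)%E by apply: mule_ge0.
(* Two reflections shift the origin of the heights by [h]. *)
rewrite -[RHS](ge0_integral_reflect (- h) mG G0).
rewrite -[RHS](@ge0_integral_reflect _ 0 (fun t => G (- h - t))).
- apply: eq_integral => t _ /=; have -> : (- h - (0 - t) = t - h)%R by ring.
  by rewrite /G /parallel_section -/h subrK.
- by apply: (measurableT_comp mG); exact: measurable_funB.
- by [].
Qed.

End sections.

(** * Compact sets between two supporting hyperplanes *)

Section compact_body.
Context {R : realType}.

Lemma continuous_sum_seq (T : topologicalType) (I : Type) (s : seq I) (F : I -> T -> R) :
  (forall i, continuous (F i)) -> continuous (fun x => \sum_(i <- s) F i x).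
Proof.
move=> cF; elim: s => [|i s IHs].
  by under eq_fun do rewrite big_nil; exact: cst_continuous.
under eq_fun do rewrite big_cons.
by move=> x; apply: continuousD; [exact: cF|exact: IHs].
Qed.

Lemma continuous_dotrr d : continuous (fun x : 'rV[R]_d => dotr x x).
Proof.
under eq_fun do rewrite dotr_sum; apply: continuous_sum_seq => i x.
by apply: continuousM; exact: coord_continuous.
Qed.

Lemma continuous_dotrl d (y : 'rV[R]_d) : continuous (fun x : 'rV[R]_d => dotr x y).
Proof.
under eq_fun do rewrite dotr_sum; apply: continuous_sum_seq => i x.
by apply: continuousM; [exact: coord_continuous|exact: cst_continuous].
Qed.

Lemma dotrr_ge0 d (x : 'rV[R]_d) : 0 <= dotr x x.
Proof. by rewrite dotr_sum; apply: sumr_ge0 => i _; rewrite -expr2 sqr_ge0. Qed.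

Lemma sqr_enorm d (x : 'rV[R]_d) : enorm x ^+ 2 = dotr x x.
Proof. by rewrite /enorm sqr_sqrtr ?dotrr_ge0. Qed.

Lemma dotrBl d (x y z : 'rV[R]_d) : dotr (x - y) z = dotr x z - dotr y z.
Proof. by rewrite /dotr mulmxBl !mxE. Qed.

(** Bounds the distances inside a set on which [dotr x x] is bounded, so that the
    supremum defining the diameter is an actual upper bound. *)
Lemma dotrrB_le d (x y : 'rV[R]_d) :
  dotr (x - y) (x - y) <= 2 * dotr x x + 2 * dotr y y.
Proof.
rewrite !dotr_sum !mulr_sumr -big_split; apply: ler_sum => i _ /=.
rewrite !mxE -subr_ge0 [X in 0 <= X](_ : _ = (x ord0 i + y ord0 i) ^+ 2) ?sqr_ge0//.
by ring.
Qed.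

Lemma coord_le_enorm d (x : 'rV[R]_d) i : `|x ord0 i| <= enorm x.
Proof.
rewrite -(@ler_pXn2r _ 2)// ?nnegrE ?sqrtr_ge0//.
by rewrite sqr_enorm real_normK ?num_real// sqr_coord_le_dotr.
Qed.

Lemma enormB_le_diameter d (D : set 'rV[R]_d) x y :
  compact D -> D x -> D y -> enorm (x - y) <= diameter D.
Proof.
move=> cD Dx Dy.
have [z _ zmax] := compact_EVT_max (ex_intro D x Dx) cD
  (continuous_subspaceT (@continuous_dotrr d)).
apply: ub_le_sup; last by exists (x, y).
exists (Num.sqrt (4 * dotr z z)) => _ [[u v] [/= Du Dv] <-].
apply: ler_wsqrtr; apply: (le_trans (dotrrB_le _ _)).
by have := zmax _ (mem_set Du); have := zmax _ (mem_set Dv); lra.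
Qed.

Lemma diameter_ge0 d (D : set 'rV[R]_d) x : compact D -> D x -> 0 <= diameter D.
Proof.
by move=> cD Dx; apply: le_trans (enormB_le_diameter cD Dx Dx); exact: sqrtr_ge0.
Qed.

Lemma measurable_compact_rV d (D : set 'rV[R]_d) : compact D -> measurable D.
Proof.
by move=> cD; apply: closed_measurable_rV; apply: compact_closed => //; exact: Hausdorff.
Qed.

Section supporting_hyperplane.
Context {d : nat} (D : set 'rV[R]_d.+1) (xi : 'rV[R]_d.+1).
Hypothesis cD : compact D.

Lemma support_minP x : D x ->
  exists x0, [/\ D x0, dotr x0 xi = support_min D xi &
    forall y, D y -> support_min D xi <= dotr y xi].
Proof.
move=> Dx; have [x0 /set_mem Dx0 x0min] := compact_EVT_min (ex_intro D x Dx) cD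
  (continuous_subspaceT (@continuous_dotrl _ xi)).
have lb : lbound [set dotr y xi | y in D] (dotr x0 xi).
  by move=> _ [y Dy <-]; exact/x0min/mem_set.
have -> : support_min D xi = dotr x0 xi.
  apply/eqP; rewrite eq_le; apply/andP; split.
    by apply: ge_inf; [exists (dotr x0 xi)|exists x0].
  by apply: lb_le_inf => //; exists (dotr x0 xi), x0.
by exists x0; split => // y Dy; exact/x0min/mem_set.
Qed.

(** All the heights of points of [D] lie in the interval on which the peaking
    polynomial is controlled. *)
Lemma dotr_sub_support_min_itv x : enorm xi = 1 -> D x ->
  0 <= dotr x xi - support_min D xi <= diameter D.
Proof.
move=> xi1 Dx; have [x0 [Dx0 <- x0min]] := support_minP Dx.
rewrite subr_ge0 [X in X && _]x0min//=; apply: le_trans (enormB_le_diameter cD Dx Dx0).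
rewrite -dotrBl; apply: le_trans (ler_norm _) _.
rewrite -(@ler_pXn2r _ 2)// ?nnegrE ?sqrtr_ge0//.
rewrite real_normK ?num_real// sqr_enorm (le_trans (sqr_dotr_le _ _))//.
by rewrite -(sqr_enorm xi) xi1 expr1n mulr1.
Qed.

Variable B : 'M[R]_(d, d.+1).
Hypotheses (xi1 : enorm xi = 1) (fr : orthonormal_frame xi B).

Lemma parallel_section_out t : ~~ (0 <= t <= diameter D) ->
  parallel_section D xi B t = 0%E.
Proof.
move=> t01; rewrite /parallel_section (_ : [set _ | _] = set0) ?measure0//.
apply/seteqP; split => // y /= Dy; have := dotr_sub_support_min_itv xi1 Dy.
by rewrite dotr_frame ?(enorm1P xi1)// addrK (negbTE t01).
Qed.

(** The frame is isometric, so a section has at most the diameter of [D] and fits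
    in a cube of half-side that diameter. *)
Lemma parallel_section_le x t : D x ->
  (parallel_section D xi B t <= ((2 * diameter D) ^+ d)%:E)%E.
Proof.
have mD := measurable_compact_rV cD => Dx; have d0 := diameter_ge0 cD Dx.
rewrite /parallel_section; set s := t + _; rewrite -/(slice D xi B s).
have [[y Dy]|noy] := pselect (exists y, slice D xi B s y); last first.
  rewrite (_ : slice D xi B s = set0) ?measure0 ?lee_fin ?exprn_ge0 ?mulr_ge0//.
  by apply/seteqP; split=> // y Dy; apply: noy; exists y.
rewrite -(lebesgue_rV_box y d0); apply: le_measure; rewrite ?inE.
- exact: measurable_slice.
- exact: measurable_box.
move=> z Dz i; apply: le_trans (enormB_le_diameter cD Dz Dy).
have -> : s *: xi + z *m B - (s *: xi + y *m B) = (z - y) *m B.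
  by rewrite opprD addrACA subrr add0r mulmxBl.
have -> : enorm ((z - y) *m B) = enorm (z - y).
  by rewrite /enorm /dotr trmx_mul mulmxA -(mulmxA _ B) fr.1 mulmx1.
by have := coord_le_enorm (z - y) i; rewrite !mxE.
Qed.

End supporting_hyperplane.
End compact_body.

(** * The integral of a power at infinity *)

Section power_tail.
Context {R : realType}.
Local Notation mu := (@lebesgue_measure R).

Lemma cvg_powRN_pinfty (s : R) : 0 < s -> x `^ (- s) @[x --> +oo] --> (0 : R).
Proof.
move=> s0; apply/cvgrPdist_lt => e e0; near=> x.
have x0 : 0 < x by near: x; exact: nbhs_pinfty_gt.
rewrite sub0r normrN ger0_norm ?powR_ge0// powRN -[e]invrK ltf_pV2; last 2 first.
- by rewrite posrE powR_gt0.
- by rewrite posrE invr_gt0.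
have -> : e^-1 = (e^-1 `^ s^-1) `^ s by rewrite -powRrM mulVf ?gt_eqF// powRr1// invr_ge0 ltW.
apply: gt0_ltr_powR; rewrite ?nnegrE ?powR_ge0 ?(ltW x0)//.
Unshelve. all: by end_near. Qed.

Lemma integral_powR_tail (s a : R) : 0 < s -> 0 < a ->
  (\int[mu]_(x in `[a, +oo[) (x `^ (- s - 1))%:E = (s^-1 * a `^ (- s))%:E)%E.
Proof.
move=> s0 a0.
pose F (x : R) := - s^-1 * x `^ (- s).
have dF (x : R) : 0 < x -> is_derive x 1 F (x `^ (- s - 1)).
  move=> x0; have dp := is_derive1_powR (- s) x0.
  have -> : F = - s^-1 \*: (fun x => x `^ (- s)) by [].
  apply: is_derive_eq; rewrite /GRing.scale/= mulrA mulrNN mulVf ?mul1r//.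
  by rewrite gt_eqF.
have -> : (s^-1 * a `^ (- s))%:E = (0%:E - (F a)%:E)%E.
  by rewrite -EFinB /F mulNr sub0r opprK.
apply: ge0_continuous_FTC2y.
- by move=> x _; exact: powR_ge0.
- apply: derivable_within_continuous => x; rewrite in_itv/= andbT => ax.
  by have [] := is_derive1_powR (- s - 1) (lt_le_trans a0 ax).
- rewrite -(mulr0 (- s^-1)); apply: cvgM; first exact: cvg_cst.
  exact: cvg_powRN_pinfty.
- by move=> x ax; have [] := dF x (lt_trans a0 ax).
- apply: cvg_at_right_filter; apply: differentiable_continuous.
  by apply/derivable1_diffP; have [] := dF a a0.
- move=> x; rewrite in_itv/= andbT => ax.
  by have d := dF x (lt_trans a0 ax); rewrite derive1E; exact: derive_val.
Qed.

End power_tail.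

(** * The lower bound for the Christoffel function *)

Section lower_bound.
Context {R : realType} {d : nat}.
Local Notation mu := (@lebesgue_measure R).
Implicit Types (D : set 'rV[R]_d.+1) (xi : 'rV[R]_d.+1) (B : 'M[R]_(d, d.+1)).

(** Up to a constant, the inverse of this quantity bounds the Christoffel function
    from below. *)
Definition section_energy D xi B (m n : nat) : \bar R :=
  (\int[mu]_(t in `[0%R, (n%:R ^- 2)%R]) parallel_section D xi B t
   + (n%:R ^- (2 * m))%:E *
     \int[mu]_(t in `[(n%:R ^- 2)%R, +oo[)
       (parallel_section D xi B t * (t ^- m)%:E))%E.

Lemma section_energy_ge0 D xi B m n : (0 <= section_energy D xi B m n)%E.
Proof.
apply: adde_ge0; first by apply: integral_ge0 => t _; exact: measure_ge0.
apply: mule_ge0; first by rewrite lee_fin invr_ge0 exprn_ge0.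
apply: integral_ge0 => t; rewrite /= in_itv/= andbT => nt.
apply: mule_ge0; first exact: measure_ge0.
by rewrite lee_fin invr_ge0 exprn_ge0// (le_trans _ nt)// invr_ge0 exprn_ge0.
Qed.

Lemma measurable_invX (m : nat) (a : R) : 0 <= a ->
  measurable_fun `[a, +oo[ (fun t : R => t ^- m).
Proof.
move=> a0; apply: (@eq_measurable_fun _ _ _ _ _ (fun t : R => t `^ (- m%:R))).
  move=> t /set_mem/=; rewrite in_itv/= andbT => at_.
  by rewrite powRN powR_mulrn// (le_trans a0).
by apply: measurable_funTS; exact: measurable_powR.
Qed.

Lemma measurable_section_tail D xi B m n : measurable D ->
  measurable_fun `[(n%:R ^- 2 : R), +oo[
    (fun t => parallel_section D xi B t * (t ^- m)%:E)%E.
Proof.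
move=> mD; apply: emeasurable_funM.
  by apply: measurable_funTS; exact: measurable_parallel_section.
apply/measurable_EFinP; apply: measurable_invX; by rewrite invr_ge0 exprn_ge0.
Qed.

(** The hypotheses on [F] are imposed only at heights where the section does not
    vanish: the peaking polynomial is bounded only on an interval. *)
Lemma integral_section_le_energy D xi B m n (c : R) (F : R -> \bar R) :
  measurable D -> 0 <= c -> measurable_fun setT F -> (forall t, 0 <= F t)%E ->
  (forall t, parallel_section D xi B t != 0 -> 0 <= t <= n%:R ^- 2 ->
     (F t <= c%:E)%E) ->
  (forall t, parallel_section D xi B t != 0 -> n%:R ^- 2 < t ->
     (F t <= (c * (n%:R ^- (2 * m) * t ^- m))%:E)%E) ->
  (forall t, t < 0 -> parallel_section D xi B t = 0%E) ->
  (\int[mu]_t (F t * parallel_section D xi B t) <=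
   c%:E * section_energy D xi B m n)%E.
Proof.
move=> mD c0 mF F0 Fnear Ftail Aneg.
pose A := parallel_section D xi B; pose a : R := n%:R ^- 2.
have a0 : 0 <= a by rewrite invr_ge0 exprn_ge0.
have mA := measurable_parallel_section xi B mD.
have A0 t : (0 <= A t)%E by exact: measure_ge0.
pose u := A \_ `[0, a].
pose v := (fun t => A t * (t ^- m)%:E)%E \_ `[a, +oo[.
have u0 t : (0 <= u t)%E by rewrite /u patchE; case: ifP.
have v0 t : (0 <= v t)%E.
  rewrite /v patchE; case: ifPn => // /set_mem/=; rewrite in_itv/= andbT => at_.
  by rewrite mule_ge0// lee_fin invr_ge0 exprn_ge0// (le_trans a0).
have mmu : measurable_fun setT u.
  by apply: (measurable_restrictT A (measurable_itv `[0, a])).1; exact: measurable_funTS.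
have mmv : measurable_fun setT v.
  apply: (measurable_restrictT _ (measurable_itv `[a, +oo[)).1.
  exact: measurable_section_tail.
have k0 : (0 <= (n%:R ^- (2 * m) : R)%:E)%E by rewrite lee_fin invr_ge0 exprn_ge0.
have -> : (c%:E * section_energy D xi B m n =
    \int[mu]_t (c%:E * (u t + (n%:R ^- (2 * m))%:E * v t)))%E.
  rewrite ge0_integralZl//; last 2 first.
  - by apply: emeasurable_funD => //; exact: emeasurable_funM.
  - by move=> t _; rewrite adde_ge0// mule_ge0.
  rewrite ge0_integralD//; last 2 first.
  - by move=> t _; rewrite mule_ge0.
  - exact: emeasurable_funM.
  by rewrite ge0_integralZl//; congr (_ * (_ + _ * _))%E; exact: integral_mkcond.
apply: ge0_le_integral => //.
- by move=> t _; rewrite mule_ge0.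
- exact: emeasurable_funM.
- by apply: emeasurable_funM => //; apply: emeasurable_funD => //; exact: emeasurable_funM.
move=> t _; rewrite -/(A t).
have [At0|At0] := eqVneq (A t) 0%E.
  by rewrite At0 mule0 mule_ge0// adde_ge0// mule_ge0.
have t0 : 0 <= t by rewrite leNgt; apply/negP => /Aneg; exact/eqP.
have [ta|ta] := leP t a.
  apply: (@le_trans _ _ (c%:E * A t)%E).
    by apply: lee_wpmul2r => //; apply: Fnear => //; rewrite t0.
  apply: lee_wpmul2l; first by rewrite lee_fin.
  have -> : u t = A t by rewrite /u patchE mem_set//= in_itv/= t0.
  by rewrite leeDl// mule_ge0.
apply: (@le_trans _ _ ((c * (n%:R ^- (2 * m) * t ^- m))%:E * A t)%E).
  by apply: lee_wpmul2r => //; exact: Ftail.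
rewrite EFinM -muleA; apply: lee_wpmul2l; first by rewrite lee_fin.
have -> : v t = (A t * (t ^- m)%:E)%E by rewrite /v patchE mem_set//= in_itv/= andbT ltW.
by rewrite EFinM -muleA (muleC (A t)) leeDr.
Qed.

Lemma christoffel_lower_bound D xi B (m n N : nat)
    (phi : 'I_N -> mpoly.mpoly d.+1 R) (L : R) :
  (0 < m)%N -> (0 < n)%N -> compact D -> (0 < lebesgue_rV d.+1 D)%E ->
  0 < L -> diameter D <= L ->
  enorm xi = 1 -> orthonormal_frame xi B -> orthonormal_basis D n phi ->
  exists2 x, D x &
    (1 <= (1 + (m%:R ^+ 2 * L) ^+ m)%:E * section_energy D xi B m n *
          (christoffel phi x)%:E)%E.
Proof.
move=> m0 n0 cD D0 L0 DL xi1 fr basis.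
have mD := measurable_compact_rV cD.
have [x Dx] : D !=set0.
  by apply/set0P/eqP => DE; move: D0; rewrite DE measure0 ltxx.
have [x0 [Dx0 x0h _]] := support_minP xi cD Dx.
exists x0 => //.
have [|p pn pE] := @ridge_polynomial R d.+1 n (peak L m (n %/ m)) xi (support_min D xi).
  by rewrite (leq_trans (size_peak _ _ _))// ltnS mulnC leq_trunc_div.
have := sqr_peval_le_christoffel x0 mD basis pn.
rewrite pE x0h subrr peak0 expr1n => /le_trans; apply.
have chr0 : 0 <= christoffel phi x0 by apply: sumr_ge0 => k _; exact: sqr_ge0.
apply: lee_wpmul2r; first by rewrite lee_fin.
pose F (t : R) : \bar R := ((peak L m (n %/ m)).[t] ^+ 2)%:E.
have -> : (\int[lebesgue_rV d.+1]_(y in D) (peval p y ^+ 2)%:E =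
    \int[lebesgue_rV d.+1]_(y in D) F (dotr y xi - support_min D xi)%R)%E.
  by apply: eq_integral => y _; rewrite pE.
have C0 : 0 <= (m%:R ^+ 2 * L) ^+ m by rewrite exprn_ge0// mulr_ge0 ?exprn_ge0// ltW.
have mF : measurable_fun setT F.
  apply/measurable_EFinP; apply: measurable_funX.
  by apply: continuous_measurable_fun; exact: continuous_horner.
have supp t : parallel_section D xi B t != 0%E -> 0 <= t <= L.
  move=> At; suff: 0 <= t <= diameter D by move=> /andP[-> tD]; rewrite (le_trans tD).
  by apply: contra_neqT At; exact: parallel_section_out.
rewrite (integral_ridge mD (enorm1P xi1) fr mF); last by move=> t; rewrite lee_fin sqr_ge0.
apply: integral_section_le_energy => //.
- by rewrite addr_ge0.
- by move=> t; rewrite lee_fin sqr_ge0.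
- move=> t /supp tL _; rewrite lee_fin (le_trans (peak_le1 _ _ L0 tL))//.
  by rewrite lerDl.
- move=> t /supp /andP[_ tL] nt; have t0 : 0 < t.
    by rewrite (lt_trans _ nt)// invr_gt0 exprn_gt0// ltr0n.
  rewrite lee_fin (le_trans (peak_tail m0 n0 _)) ?t0//.
  apply: ler_wpM2r; last by rewrite lerDr.
  by rewrite mulr_ge0// invr_ge0 exprn_ge0// ltW.
- move=> t t0; apply: parallel_section_out => //.
  by rewrite negb_and -ltNge t0.
Qed.

End lower_bound.

(** * Sections bounded by a power *)

Section power_growth.
Context {R : realType} {d : nat}.
Local Notation mu := (@lebesgue_measure R).
Implicit Types (D : set 'rV[R]_d.+1) (xi : 'rV[R]_d.+1) (B : 'M[R]_(d, d.+1)).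

(** With [a = n ^ (-2)], each of the two integrals is at most a constant times
    [a ^ (1 + lambda)]. *)
Lemma section_energy_power_le D xi B (m n : nat) (M lambda : R) :
  measurable D -> (0 < n)%N -> 0 <= M -> 0 <= lambda -> lambda < m%:R - 1 ->
  (forall t, 0 < t -> (parallel_section D xi B t <= (M * t `^ lambda)%:E)%E) ->
  (section_energy D xi B m n <=
   (M * (1 + (m%:R - 1 - lambda)^-1) * n%:R `^ (- (2 * (1 + lambda))))%:E)%E.
Proof.
move=> mD n0 M0 l0 lm AM.
have np : 0 < n%:R :> R by rewrite ltr0n.
pose a : R := n%:R ^- 2.
have a0 : 0 < a by rewrite invr_gt0 exprn_gt0.
have aE : n%:R `^ (- (2 * (1 + lambda))) = a `^ (1 + lambda).
  rewrite -mulNr powRrM; congr (_ `^ _).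
  by rewrite powRN powR_mulrn// ltW.
have mA := measurable_parallel_section xi B mD.
pose s := m%:R - 1 - lambda.
have s0 : 0 < s by rewrite subr_gt0.
have near : (\int[mu]_(t in `[0%R, a]) parallel_section D xi B t <=
    (M * a `^ (1 + lambda))%:E)%E.
  (* The bound on the sections says nothing at height 0, a null set. *)
  rewrite -integral_itv_obnd_cbnd; last exact: measurable_funTS.
  apply: (@le_trans _ _ (\int[mu]_(t in `]0%R, a]) (M * a `^ lambda)%:E)%E).
    apply: ge0_le_integral => //.
    - exact: measurable_funTS.
    - move=> t; rewrite /= in_itv/= => /andP[t0 ta].
      apply: (le_trans (AM t t0)); rewrite lee_fin ler_wpM2l//.
      by rewrite ge0_ler_powR// nnegrE ltW.
  rewrite integral_cst// [X in (_ * X)%E](lebesgue_measure_itv `]0, a])/= lte_fin a0.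
  rewrite sube0 -EFinM lee_fin -mulrA -{2}(powRr1 (ltW a0)) -powRD ?(addrC lambda)//.
  by apply/implyP => _; rewrite gt_eqF.
have tail : (\int[mu]_(t in `[a, +oo[) (parallel_section D xi B t * (t ^- m)%:E) <=
    (M * (s^-1 * a `^ (- s)))%:E)%E.
  have mp : measurable_fun `[a, +oo[ (fun t : R => (t `^ (- s - 1))%:E : \bar R).
    by apply/measurable_EFinP; apply: measurable_funTS; exact: measurable_powR.
  rewrite EFinM -(integral_powR_tail s0 a0).
  rewrite -ge0_integralZl//; last by move=> t _; rewrite lee_fin powR_ge0.
  apply: ge0_le_integral => //.
  - move=> t; rewrite /= in_itv/= andbT => at_; rewrite mule_ge0 ?measure_ge0//.
    by rewrite lee_fin invr_ge0 exprn_ge0// (le_trans (ltW a0)).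
  - exact: measurable_section_tail.
  - exact: emeasurable_funM.
  - move=> t; rewrite /= in_itv/= andbT => at_; have t0 := lt_le_trans a0 at_.
    apply: (@le_trans _ _ ((M * t `^ lambda)%:E * (t ^- m)%:E)%E).
      apply: lee_wpmul2r; last exact: AM.
      by rewrite lee_fin invr_ge0 exprn_ge0// ltW.
    rewrite -!EFinM lee_fin -mulrA -powR_mulrn ?(ltW t0)// -powRN -powRD; last first.
      by apply/implyP => _; rewrite gt_eqF.
    by rewrite /s (_ : _ - _ = - (m%:R - 1 - lambda) - 1)//; ring.
apply: (le_trans (leeD near (lee_wpmul2l _ tail))).
  by rewrite lee_fin invr_ge0 exprn_ge0.
rewrite -EFinM -EFinD lee_fin aE exprM -exprVn -/a.
rewrite -(powR_mulrn _ (ltW a0)).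
rewrite (_ : a `^ m%:R * _ = M * s^-1 * (a `^ m%:R * a `^ (- s))); last by ring.
rewrite -powRD; last by apply/implyP => _; rewrite gt_eqF.
rewrite (_ : m%:R - s = 1 + lambda); last by rewrite /s; ring.
by rewrite mulrDr mulr1 mulrDl.
Qed.

(** The hypothesis excludes [E = 0], and the inverse of [+oo] is 0. *)
Lemma lee_inv_of_mul (E : \bar R) (C r : R) : 0 < C -> 0 <= r -> (0 <= E)%E ->
  (1 <= C%:E * E * r%:E)%E -> ((C^-1)%:E * E^-1 <= r%:E)%E.
Proof.
move=> C0 r0; case: E => [e| |]//; last by rewrite invey mule0 lee_fin.
rewrite lee_fin le_eqVlt => /predU1P[<-|e0]; first by rewrite mule0 mul0e lee_fin ler10.
rewrite -!EFinM inver gt_eqF// -EFinM !lee_fin -invfM => le1.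
by rewrite -[leLHS]mulr1 ler_pdivrMl// mulr_gt0.
Qed.

Lemma christoffel_sup_ge D N (phi : 'I_N -> mpoly.mpoly d.+1 R) x : D x ->
  ((christoffel phi x)%:E <= christoffel_sup phi D)%E.
Proof. by move=> Dx; apply: ereal_sup_ubound; exists x. Qed.

Lemma christoffel_ge0 N (phi : 'I_N -> mpoly.mpoly d.+1 R) x : 0 <= christoffel phi x.
Proof. by apply: sumr_ge0 => k _; exact: sqr_ge0. Qed.

Lemma christoffel_power_growth (m : nat) (delta M lambda : R) :
  (0 < m)%N -> 0 < M -> 0 <= lambda -> lambda < m%:R - 1 ->
  exists2 c : R, 0 < c &
    forall D xi B (n N : nat) (phi : 'I_N -> mpoly.mpoly d.+1 R),
      compact D -> (0 < lebesgue_rV d.+1 D)%E -> diameter D = delta ->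
      enorm xi = 1 -> orthonormal_frame xi B ->
      (1 <= n)%N -> orthonormal_basis D n phi ->
      (forall t : R, 0 < t ->
        (parallel_section D xi B t <= (M * t `^ lambda)%:E)%E) ->
      ((c * n%:R `^ (2 * (1 + lambda)))%:E <= christoffel_sup phi D)%E.
Proof.
move=> m0 M0 l0 lm; pose L := `|delta| + 1.
have L0 : 0 < L by rewrite ltr_wpDl.
pose C : R := 1 + (m%:R ^+ 2 * L) ^+ m.
have C0 : 0 < C by rewrite ltr_pwDl// exprn_ge0// mulr_ge0 ?exprn_ge0// ltW.
pose K : R := M * (1 + (m%:R - 1 - lambda)^-1).
have K0 : 0 < K by rewrite mulr_gt0// ltr_pwDl// invr_ge0 ltW// subr_gt0.
have CK0 : 0 < C * K by exact: mulr_gt0.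
exists (C * K)^-1; first by rewrite invr_gt0.
move=> D xi B n N phi cD D0 Dd xi1 fr n0 basis AM.
have DL : diameter D <= L by rewrite Dd (le_trans (ler_norm _))// lerDl.
have [x Dx] := christoffel_lower_bound m0 n0 cD D0 L0 DL xi1 fr basis.
rewrite -/C => lower; apply: le_trans (christoffel_sup_ge phi Dx).
have mD := measurable_compact_rV cD.
have := section_energy_power_le mD n0 (ltW M0) l0 lm AM.
rewrite -/K => upper; set r := christoffel phi x in lower *.
have {lower upper} : 1 <= C * (K * n%:R `^ (- (2 * (1 + lambda)))) * r.
  rewrite -lee_fin; apply: (le_trans lower); rewrite !EFinM.
  apply: lee_wpmul2r; first by rewrite lee_fin christoffel_ge0.
  by apply: lee_wpmul2l; [rewrite lee_fin ltW|rewrite -EFinM].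
rewrite powRN; set w := n%:R `^ _; have w0 : 0 < w by apply: powR_gt0; rewrite ltr0n.
rewrite lee_fin ler_pdivrMl// => lower.
rewrite -[leLHS]mul1r; apply: (le_trans (ler_wpM2r (ltW w0) lower)).
by rewrite le_eqVlt; apply/orP; left; apply/eqP; field; rewrite gt_eqF.
Qed.

End power_growth.

Theorem theorem6p2 (R : realType) (d m : nat) (delta : R) (hm : (1 <= m)%N) :
  (exists2 c : R, 0 < c &
    forall (D : set 'rV[R]_d.+1) (xi : 'rV[R]_d.+1) (B : 'M[R]_(d, d.+1))
        (n N : nat) (phi : 'I_N -> mpoly.mpoly d.+1 R),
      compact D -> (0 < lebesgue_rV d.+1 D)%E -> diameter D = delta ->
      enorm xi = 1 -> orthonormal_frame xi B ->
      (1 <= n)%N -> orthonormal_basis D n phi ->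
      (c%:E *
        ((\int[lebesgue_measure]_(t in `[0%R, (n%:R ^- 2)%R]) parallel_section D xi B t)
         + (n%:R ^- (2 * m))%:E *
           (\int[lebesgue_measure]_(t in `[(n%:R ^- 2)%R, +oo[)
              (parallel_section D xi B t * (t ^- m)%:E)))^-1
       <= christoffel_sup phi D)%E)
  /\
  (forall M lambda : R, 0 < M -> lambda < m%:R - 1 ->
    exists2 c : R, 0 < c &
      forall (D : set 'rV[R]_d.+1) (xi : 'rV[R]_d.+1) (B : 'M[R]_(d, d.+1))
          (n N : nat) (phi : 'I_N -> mpoly.mpoly d.+1 R),
        compact D -> (0 < lebesgue_rV d.+1 D)%E -> diameter D = delta ->
        enorm xi = 1 -> orthonormal_frame xi B ->
        (1 <= n)%N -> orthonormal_basis D n phi ->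
        (forall t : R, 0 < t ->
          (parallel_section D xi B t <= (M * t `^ lambda)%:E)%E) ->
        ((c * n%:R `^ (2 * (1 + lambda)))%:E <= christoffel_sup phi D)%E).
Proof.
split.
  pose L := `|delta| + 1; have L0 : 0 < L by rewrite ltr_wpDl.
  pose C : R := 1 + (m%:R ^+ 2 * L) ^+ m.
  have C0 : 0 < C by rewrite ltr_pwDl// exprn_ge0// mulr_ge0 ?exprn_ge0// ltW.
  exists C^-1; first by rewrite invr_gt0.
  move=> D xi B n N phi cD D0 Dd xi1 fr n0 basis.
  have DL : diameter D <= L by rewrite Dd (le_trans (ler_norm _))// lerDl.
  have [x Dx lower] := christoffel_lower_bound hm n0 cD D0 L0 DL xi1 fr basis.
  apply: le_trans (christoffel_sup_ge phi Dx).
  apply: lee_inv_of_mul lower => //; first exact: christoffel_ge0.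
  exact: section_energy_ge0.
move=> M lambda M0 lm; have [l0|l0] := leP 0 lambda.
  exact: (@christoffel_power_growth R d m delta M lambda hm M0 l0 lm).
(* A section of [D] fits in a cube of half-side [delta]. *)
have M'0 : 0 < (2 * `|delta|) ^+ d + 1 by rewrite ltr_wpDl// exprn_ge0// mulr_ge0.
have l2 : 0 < 2%:R - 1 :> R by rewrite subr_gt0 ltr1n.
have [c c0 growth] := @christoffel_power_growth R d 2 delta _ 0 isT M'0 (lexx 0) l2.
exists c => // D xi B n N phi cD D0 Dd xi1 fr n0 basis _.
apply: le_trans (growth D xi B n N phi cD D0 Dd xi1 fr n0 basis _).
  rewrite lee_fin ler_wpM2l ?(ltW c0)// ler_powR ?ler1n//.
  by rewrite ler_pM2l// lerD2l ltW.
move=> t t0; rewrite powRr0 mulr1.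
have [x Dx] : D !=set0.
  by apply/set0P/eqP => DE; move: D0; rewrite DE measure0 ltxx.
have delta0 : 0 <= delta by rewrite -Dd (diameter_ge0 cD Dx).
apply: (le_trans (parallel_section_le cD fr t Dx)); rewrite Dd ger0_norm//.
by rewrite lee_fin lerDl.
Qed.
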